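(* Let $G$ be a graph with $m$ edges and with no isolated vertices such that $\rho(G)\geq \sqrt{m}$ and $G$ is not isomorphic to any complete bipartite graph. Then $\tau(G)\geq \rho(G)$.
   Context: Graphs are finite, simple, undirected and have at least one vertex. $\rho(G)$ denotes the spectral radius of $G$, i.e. the largest eigenvalue of its adjacency matrix. An edge of $G$ is triangular if it is contained in a triangle of $G$; $T(G)$ is the set of all triangular edges of $G$ and $\tau(G)=|T(G)|$. *)

(* Defs.v *)
From HB Require Import structures.
From mathcomp Require Import all_boot all_order all_algebra.
From mathcomp Require Import complex polyrcf.

Set Implicit Arguments.
Unset Strict Implicit.
Unset Printing Implicit Defensive.

Import Order.TTheory GRing.Theory Num.Theory.
Local Open Scope ring_scope.

Record sgraph := SGraph {
  vertex :> finType;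
  adj : rel vertex;
  adj_sym : symmetric adj;
  adj_irrefl : irreflexive adj
}.

Definition edges (G : sgraph) : {set {set G}} :=
  [set [set p.1; p.2] | p : G * G & adj p.1 p.2].

Definition is_triangle (G : sgraph) (t : {set G}) : bool :=
  (#|t| == 3%N) && [forall x in t, forall y in t, (x != y) ==> adj x y].

Definition triangular_edges (G : sgraph) : {set {set G}} :=
  [set f in edges G | [exists t : {set G}, is_triangle t && (f \subset t)]].

Definition no_isolated (G : sgraph) : Prop :=
  forall x : G, exists y : G, adj x y.

Definition isomorphic (G H : sgraph) : Prop :=
  exists2 f : G -> H, bijective f & {mono f : x y / adj x y}.

Section CompleteBipartite.
Variables a b : nat.

Definition kab_adj : rel ('I_a + 'I_b) := fun x y =>
  match x, y with
  | inl _, inr _ | inr _, inl _ => true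
  | _, _ => false
  end.

Lemma kab_sym : symmetric kab_adj. Proof. by case=> ? []. Qed.
Lemma kab_irrefl : irreflexive kab_adj. Proof. by case. Qed.

Definition complete_bipartite : sgraph := SGraph kab_sym kab_irrefl.
End CompleteBipartite.

(* Rows and columns are numbered by the enumeration of the vertices. *)
Definition adjmx (R : pzRingType) (G : sgraph) : 'M[R]_#|G| :=
  \matrix_(i, j) (adj (enum_val i) (enum_val j))%:R.

Definition is_spectral_radius (R : rcfType) (G : sgraph) (rho : R) : Prop :=
  eigenvalue (adjmx R G) rho /\
  forall a : R, eigenvalue (adjmx R G) a -> a <= rho.

Lemma spectral_radius_uniq (R : rcfType) (G : sgraph) (r s : R) :
  is_spectral_radius G r -> is_spectral_radius G s -> r = s.
Proof.
by move=> [er mr] [es ms]; apply: le_anti; rewrite ms // mr.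
Qed.

Lemma sym_real_eigenvalue (R : rcfType) n (A : 'M[R]_n) :
  (0 < n)%N -> A^T = A -> exists a : R, eigenvalue A a.
Proof.
move=> n0 sA; pose f := real_complex R; pose B := map_mx f A.
have [c /eigenvalueP [v vB v0]] := eigenvalue_closed B n0.
have BT : B^T = B by apply/matrixP=> i j; rewrite /B -[in RHS]sA !mxE.
have Bc : map_mx (@Num.conj R[i]) B = B.
  apply/matrixP=> i j; rewrite !mxE; apply/CrealP.
  by rewrite complex_real.
pose w := map_mx (@Num.conj R[i]) v.
have wB : B *m w^T = Num.conj c *: w^T.
  have : map_mx (@Num.conj R[i]) (v *m B) = map_mx (@Num.conj R[i]) (c *: v).
    by rewrite vB.
  rewrite map_mxM map_mxZ Bc => /(congr1 trmx).
  by rewrite trmx_mul BT linearZ.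
have vw : (v *m w^T) 0 0 != 0.
  rewrite mxE; apply: contra v0 => /eqP s0.
  have nn k : true -> 0 <= v 0 k * w^T k 0 by rewrite !mxE -normCK exprn_ge0.
  apply/eqP/rowP=> k; have: v 0 k * w^T k 0 = 0 by exact: (psumr_eq0P nn s0).
  rewrite !mxE -normCK => /eqP; rewrite expf_eq0 /= normr_eq0.
  by move/eqP.
have cr : c = Num.conj c.
  have : v *m B *m w^T = v *m (B *m w^T) by rewrite mulmxA.
  rewrite vB wB -scalemxAl -scalemxAr => /matrixP /(_ 0 0).
  by rewrite [LHS]mxE [RHS]mxE; apply: mulIf.
have /complex_realP [a ca] : c \is Num.real by apply/CrealP.
exists a; rewrite -(eigenvalue_map f) -/B.
by apply/eigenvalueP; exists v => //; rewrite vB ca.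
Qed.

Lemma spectral_radius_exists (R : rcfType) (G : sgraph) :
  (0 < #|G|)%N -> exists rho : R, is_spectral_radius G rho.
Proof.
move=> G0; have sA : (adjmx R G)^T = adjmx R G.
  by apply/matrixP=> i j; rewrite !mxE adj_sym.
have [a ea] := sym_real_eigenvalue G0 sA.
pose s := rootsR (char_poly (adjmx R G)).
have es x : eigenvalue (adjmx R G) x = (x \in s).
  rewrite eigenvalue_root_char -roots_on_rootsR //.
  by rewrite monic_neq0 ?char_poly_monic.
have sm : a \in s by rewrite -es.
have [rho rs rmax] : exists2 r, r \in s & {in s, forall x, x <= r}.
  have : s != [::] by case: (s) sm.
  elim: (s) => // x [|y t] IH _.
    by exists x; rewrite ?mem_head // => z; rewrite inE => /eqP->.
  have [r rt rm] := IH isT; have [xr|rx] := leP x r.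
    exists r; first by rewrite inE rt orbT.
    by move=> z; rewrite inE => /orP[/eqP->//|/rm].
  exists x; rewrite ?mem_head // => z; rewrite inE => /orP[/eqP->//|/rm zr].
  exact: le_trans zr (ltW rx).
by exists rho; split; [rewrite es | move=> x; rewrite es => /rmax].
Qed.

(* Main.v *)
Require Import Defs.
From mathcomp Require Import all_boot all_order all_algebra.
From mathcomp Require Import complex reals.
From mathcomp Require Import ring lra.

Set Implicit Arguments.
Unset Strict Implicit.
Unset Printing Implicit Defensive.

Import Order.TTheory GRing.Theory Num.Theory.
Local Open Scope ring_scope.

(** Let A be the adjacency matrix, rho the spectral radius, x >= 0 a Perron
    vector scaled so that its largest entry is x(u) = 1, N the set of neighbours
    of u, W the vertices outside {u} and N, and tau the number of triangular
    edges.

    Expanding rho^2 x(u) as the weight of the walks of length two from u, and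
    comparing with the number m <= rho^2 of edges, bounds what the edges missing
    between N and W cost by what the edges inside N gain: an edge ab inside N
    gains x(a) + x(b) - 1, and a missing pair bw, with b in N and w in W, costs
    x(b) x(w).  An edge ww' inside W gains at most x(w) x(w'), and these gains are
    absorbed by the costs, since the W-neighbours of w weigh at most what w misses
    in N.  For Z included in W this gives [absorption]: the gains inside N are at
    least the cost of Z less the gains inside Z.  If N spans no edge then nothing
    is missing and G is complete bipartite ([independent_nbhd_complete]).

    Otherwise take an edge vz inside N of largest weight x(v) + x(z), with
    x(z) <= x(v).  The edges inside N, and those from u to a vertex of N that has
    a neighbour in N, are triangular.  A W-neighbour w of v brings two more
    triangular edges, unless it belongs to a certain independent set I of
    vertices missing every N-neighbour of v ([private_neighbours]).  As rho x(v)
    is the total weight around v, tau falls short of rho only when I is heavy;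
    then the cost of I exceeds the gains inside N, by a polynomial inequality in a
    few numbers ([many_triangular_edges]).

    That inequality needs rho >= 5, so it settles the case tau >= 5.  If tau < rho
    and tau < 5, then vz is the only edge inside N and no triangle
    meets both N and W ([no_cross_triangle]).  Two adjacent vertices of W then have
    no common neighbour in N, so the gains inside W are absorbed in full and
    balancing the weights around v and z rules out rho > 3 ([one_triangle]).  The
    bound is sharp: joining two vertices of the side of size 4b + 4 in
    K_(b, 4b + 4) gives rho^2 = m and tau = rho = 2b + 1. *)

(** * A nonnegative eigenvector for the spectral radius *)

Section Perron.
Local Open Scope sesquilinear_scope.

(** The largest eigenvalue of a symmetric matrix dominates its Rayleigh
    quotients: diagonalize the matrix unitarily over R[i], where the coordinates
    c i of x weigh the real eigenvalues by the squares of their norms. *)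
Lemma rayleigh_le (R : rcfType) n (A : 'M[R]_n) (r : R) (x : 'rV[R]_n) :
  A^T = A -> (forall a, eigenvalue A a -> a <= r) ->
  \sum_i \sum_j x 0 i * A i j * x 0 j <= r * \sum_i x 0 i ^+ 2.
Proof.
move=> sA le_r; pose f := real_complex R; pose B := map_mx f A.
have hB : B \is hermsymmx.
  apply/is_hermitianmxP; rewrite expr0 scale1r.
  apply/matrixP=> i j; rewrite /B -[in LHS]sA !mxE; apply/esym/CrealP.
  by rewrite complex_real.
have nB := hermitian_normalmx hB.
pose P := spectralmx B; pose d := spectral_diag B.
have uP : P \is unitarymx by exact: spectral_unitarymx.
have BE : B = P^t* *m diag_mx d *m P.
  by rewrite -invmx_unitary //; exact/orthomx_spectralP.
have dr i : exists2 a, d 0 i = f a & a <= r.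
  have /mxOverP /(_ 0 i) /complex_realP [a da] :=
    hermitian_spectral_diag_real hB.
  exists a => //; apply: le_r; rewrite -(eigenvalue_map f) -/B.
  apply/eigenvalueP; exists (row i P).
    rewrite -row_mul BE !mulmxA (unitarymxP uP) mul1mx.
    by rewrite row_mul row_diag_mx -scalemxAl -rowE da.
  apply/negP => /eqP /(congr1 (fun v => v *m P^t*)).
  rewrite -row_mul (unitarymxP uP) mul0mx => /matrixP /(_ 0 i).
  by rewrite !mxE eqxx => /eqP; rewrite oner_eq0.
pose y := map_mx f x.
have yC : y ^t* = y^T.
  by apply/matrixP=> i j; rewrite !mxE; apply/CrealP; rewrite complex_real.
pose c := y *m P^t*.
have quad : (y *m B *m y^T) 0 0 = \sum_i d 0 i * `|c 0 i| ^+ 2.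
  have -> : y *m B *m y^T = c *m diag_mx d *m c^t*.
    by rewrite BE /c trmx_mul map_mxM trmxCK yC !mulmxA.
  rewrite mxE; apply: eq_bigr => i _.
  by rewrite mul_mx_diag !mxE normCK; ring.
have norm : (y *m y^T) 0 0 = \sum_i `|c 0 i| ^+ 2.
  have -> : y *m y^T = c *m c^t*.
    by rewrite /c trmx_mul map_mxM trmxCK yC mulmxA mulmxKtV.
  by rewrite mxE; apply: eq_bigr => i _; rewrite !mxE normCK.
have quadE : (y *m B *m y^T) 0 0 = f (\sum_i \sum_j x 0 i * A i j * x 0 j).
  rewrite exchange_big /f mxE rmorph_sum; apply: eq_bigr => j _.
  rewrite !mxE mulr_suml rmorph_sum; apply: eq_bigr => i _.
  by rewrite !mxE !rmorphM.
have normE : (y *m y^T) 0 0 = f (\sum_i x 0 i ^+ 2).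
  rewrite /f mxE rmorph_sum; apply: eq_bigr => j _.
  by rewrite !mxE expr2 rmorphM.
rewrite -(lecR (_ : R)) rmorphM /= -/f -quadE -normE quad norm mulr_sumr.
apply: ler_sum => i _; have [a -> ar] := dr i.
by rewrite ler_wpM2r ?exprn_ge0 // lecR.
Qed.
End Perron.

(** An isotropic vector x of a semidefinite form lies in its kernel: moving
    from x to x + t v, where v = x M, changes the form by 2 t |v|^2 up to O(t^2),
    and for a small t < 0 it would become negative. *)
Lemma psd_isotropic (R : realFieldType) n (M : 'M[R]_n) (x : 'rV[R]_n) :
  M^T = M -> (forall w : 'rV_n, 0 <= (w *m M *m w^T) 0 0) ->
  (x *m M *m x^T) 0 0 <= 0 -> x *m M = 0.
Proof.
have aux (e t N q : R) : e <= 0 -> t * (2 * N + t * q) < 0 ->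
    0 <= e + t * N + t * N + t * (t * q) -> x *m M = 0.
  by clear=> e0 neg; rewrite leNgt => /negP[]; lra.
move=> sM psd x0; pose v := x *m M.
pose N := \sum_i v 0 i ^+ 2; pose q : R := (v *m M *m v^T) 0 0.
have xv : (x *m M *m v^T) 0 0 = N.
  by rewrite mxE; apply: eq_bigr => i _; rewrite !mxE expr2.
have vx : (v *m M *m x^T) 0 0 = N.
  have <- : (x *m M *m v^T)^T = v *m M *m x^T.
    by rewrite trmx_mul trmxK trmx_mul sM mulmxA.
  by rewrite mxE.
have [N0|N0] := eqVneq N 0.
  apply/rowP=> i; rewrite [RHS]mxE; apply/eqP; rewrite -sqrf_eq0; apply/eqP.
  by apply: (psumr_eq0P _ N0) => // j _; rewrite sqr_ge0.
have Np : 0 < N by rewrite lt0r N0 sumr_ge0 // => i _; rewrite sqr_ge0.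
have q0 : 0 <= q by exact: psd.
(* small enough for the linear term to beat t ^ 2 * q *)
pose t := - (N / (q + 1)).
have expand : ((x + t *: v) *m M *m (x + t *: v)^T) 0 0
    = (x *m M *m x^T) 0 0 + t * N + t * N + t * (t * q).
  rewrite linearD linearZ /= !mulmxDl !mulmxDr -!scalemxAl -!scalemxAr.
  rewrite ![(_ + _ : 'M_1) 0 0]mxE ![(_ *: _ : 'M_1) 0 0]mxE xv vx -/q.
  ring.
have := psd (x + t *: v); rewrite expand.
have q1 : 0 < q + 1 by rewrite ltr_wpDl.
have qt : t * (q + 1) = - N by rewrite /t mulNr divfK // gt_eqF.
have tn : t < 0 by rewrite /t oppr_lt0 divr_gt0.
have : t * (2 * N + t * q) < 0.
  by rewrite nmulr_rlt0 //; clear -qt Np tn; lra.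
exact: aux x0.
Qed.

(** Passing from an eigenvector z to its entrywise norm can only increase the
    quadratic form of A, so the norm attains the maximal Rayleigh quotient and is
    an eigenvector as well.  If G is disconnected, some entries may vanish. *)
Lemma perron (R : rcfType) (G : sgraph) (rho : R) :
  is_spectral_radius G rho ->
  exists x : G -> R, [/\ forall a, 0 <= x a,
    forall a, \sum_b (adj a b)%:R * x b = rho * x a &
    exists2 u, x u = 1 & forall a, x a <= 1].
Proof.
case=> /eigenvalueP [z zA z0] rho_max; pose A := adjmx R G.
have sA : A^T = A by apply/matrixP=> i j; rewrite !mxE adj_sym.
pose M := rho%:M - A; pose x := \row_i `|z 0 i|.
have quad w : (w *m M *m w^T) 0 0 =
    rho * (\sum_i w 0 i ^+ 2) - \sum_i \sum_j w 0 i * A i j * w 0 j.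
  rewrite mulmxBr mulmxBl mxE [in X in _ + X]mxE; congr (_ - _).
    rewrite mul_mx_scalar -scalemxAl !mxE; congr (_ * _).
    by apply: eq_bigr => i _; rewrite !mxE expr2.
  rewrite exchange_big mxE; apply: eq_bigr => j _.
  by rewrite !mxE mulr_suml.
have /rowP xM : x *m M = 0.
  apply: psd_isotropic => [|w|].
  - by rewrite /M linearB /= tr_scalar_mx sA.
  - by rewrite quad subr_ge0; exact: rayleigh_le.
  rewrite quad.
  have -> : \sum_i x 0 i ^+ 2 = \sum_i z 0 i ^+ 2.
    by apply: eq_bigr => i _; rewrite mxE real_normK // num_real.
  have : \sum_i \sum_j z 0 i * A i j * z 0 j = rho * \sum_i z 0 i ^+ 2.
    rewrite exchange_big mulr_sumr; apply: eq_bigr => j _.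
    have /rowP /(_ j) := zA; rewrite !mxE -mulr_suml => ->.
    by rewrite expr2 mulrA.
  move=> <-; rewrite subr_le0; apply: ler_sum => i _; apply: ler_sum => j _.
  rewrite !mxE; apply: le_trans (ler_norm _) _.
  by rewrite !normrM [`|_%:R|]ger0_norm.
have [j0 zj0] : exists j, z 0 j != 0.
  apply/existsP; apply: contraNT z0 => /existsPn z0; apply/eqP/rowP=> j.
  by rewrite mxE; have /negPn/eqP := z0 j.
pose y a := x 0 (enum_rank a).
have yA a : \sum_b (adj a b)%:R * y b = rho * y a.
  have := xM (enum_rank a); rewrite mulmxBr mul_mx_scalar [LHS]mxE.
  rewrite [X in _ + X]mxE [X in X - _]mxE [RHS]mxE => /eqP.
  rewrite subr_eq0 => /eqP ->; rewrite mxE.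
  rewrite (reindex _ (onW_bij _ (@enum_val_bij G))) /=.
  apply: eq_bigr => i _; rewrite /y enum_valK !mxE enum_rankK mulrC.
  by rewrite adj_sym.
have [u _ umax] := @arg_maxP _ _ G (enum_val j0) predT y isT.
have yu : 0 < y u.
  apply: lt_le_trans (umax (enum_val j0) isT).
  by rewrite /y enum_valK mxE normr_gt0.
exists (fun a => y a / y u); split=> [a|a|].
- by apply: divr_ge0; [rewrite /y mxE | exact: ltW].
- by rewrite mulrA -yA mulr_suml; apply: eq_bigr => b _; rewrite mulrA.
exists u; first by rewrite divff ?gt_eqF.
by move=> a; rewrite ler_pdivrMr // mul1r; exact: umax.
Qed.

(** * The numerical inequalities

    In this part y >= z are the weights x(v) and x(z) of the ends of a heaviest
    edge inside N; d is the number of N-neighbours of v and P their weight; D is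
    the weight of an independent set of W-neighbours of v that miss all of
    these; k is the number of edges inside N, and n that of the vertices of N
    incident to them. *)

(** Suppose the conclusion fails.  Multiplying its negation by P and bounding
    D * P by the hypothesis leaves a polynomial inequality in which the
    coefficients of k - d and n - d - 1 are nonnegative once rho is bounded below
    by k + n; what remains is a quadratic in y without real root. *)
Lemma numeric_deg_ge2 (R : realFieldType) (rho y z P D k d n : R) :
  z <= y -> y <= 1 -> 1 <= y + z -> 0 < z -> z <= P -> P <= d * z ->
  2 <= d -> d <= k -> d + 1 <= n ->
  k + n <= rho ->
  D * P <= P - d * (1 - y) + (k - d) * (y + z - 1) ->
  rho <= k + n + 2 * (rho * y - 1 - P - D).
Proof.
move=> zy y1 yz z0 zP Pd d2 dk dn kn HD; rewrite leNgt; apply/negP => H.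
have y2 : 1 <= 2 * y by lra.
have P0 : 0 < P by lra.
have h1 : 0 <= (rho - (k + n)) * (2 * y - 1) * P by rewrite !mulr_ge0 //; lra.
(* P * y >= z * y >= y + z - 1 *)
have h2 : 0 <= (k - d) * (P * y - (y + z - 1)).
  rewrite mulr_ge0 //; first lra.
  have : 0 <= (1 - y) * (1 - z) by rewrite mulr_ge0 //; lra.
  have : 0 <= (P - z) * y by rewrite mulr_ge0 //; lra.
  lra.
have h3 : 0 <= (n - d - 1) * (2 * y) * P by rewrite !mulr_ge0 //; lra.
have H' : (k + n + rho * (2 * y - 1) - 2 - 2 * P - 2 * D) * P < 0.
  by rewrite pmulr_llt0 //; lra.
have PP : P * P <= d * y * P.
  rewrite ler_pM2r //; apply: le_trans Pd _; rewrite ler_pM2l //; lra.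
(* the extreme case k = d and n = d + 1, with - 2 * P ^+ 2 replaced by
   - 2 * d * y * P; it is linear in P *)
have c1 : (2 * d * y + 2 * y - 4) * P + 2 * d * (1 - y) < 0 by lra.
have [c0|c0] := leP 0 (2 * d * y + 2 * y - 4).
  have : 0 <= (2 * d * y + 2 * y - 4) * P by rewrite mulr_ge0 // ltW.
  have : 0 <= d * (1 - y) by rewrite mulr_ge0 //; lra.
  lra.
have Pdy : P <= d * y by apply: le_trans Pd _; rewrite ler_pM2l //; lra.
have c2 : (2 * d * y + 2 * y - 4) * (d * y) <= (2 * d * y + 2 * y - 4) * P.
  by rewrite ler_nM2l.
have : d * (2 * d * y * y + 2 * y * y - 4 * y + 2 * (1 - y)) < 0 by lra.
rewrite pmulr_rlt0; last lra.
have : 0 <= (d - 2) * (y * y) by rewrite mulr_ge0 ?mulr_ge0 //; lra.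
have := sqr_ge0 (2 * y - 1).
nra.
Qed.

(** For d = 1 the extreme values k = 1 and n = 2 are not covered by the bound
    rho >= k + n alone; a third vertex of N on an edge inside N provides enough
    slack. *)
Lemma numeric_deg1_apex_ge3 (R : realFieldType) (rho y z D k n : R) :
  z <= y -> y <= 1 -> 1 <= y + z -> 0 < z -> 1 <= k -> 3 <= n ->
  k + n <= rho ->
  D * z <= z - (1 - y) + (k - 1) * (y + z - 1) ->
  rho <= k + n + 2 * (rho * y - 1 - z - D).
Proof.
move=> zy y1 yz z0 k1 n3 kn HD; rewrite leNgt; apply/negP => H.
have h1 : 0 <= (rho - (k + n)) * (2 * y - 1) * z by rewrite !mulr_ge0 //; lra.
have h2 : 0 <= (k - 1) * ((1 - y) * (1 - z)) by rewrite !mulr_ge0 //; lra.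
have h3 : 0 <= (n - 3) * (2 * y) * z by rewrite !mulr_ge0 //; lra.
have H' : (k + n + rho * (2 * y - 1) - 2 - 2 * z - 2 * D) * z < 0.
  by rewrite pmulr_llt0 //; lra.
nra.
Qed.

(** The remaining values k = 1 and d = 1.  At y = z, n = 2 and
    rho = 5 the margin, multiplied by z, is 2 * (2 * y - 1) ^+ 2. *)
Lemma numeric_deg1_apex2 (R : realFieldType) (rho y z D n : R) :
  z <= y -> y <= 1 -> 1 <= y + z -> 0 < z -> 2 <= n -> 5 <= rho ->
  D * z <= z - (1 - y) ->
  rho <= 1 + n + 2 * (rho * y - 1 - z - D).
Proof.
move=> zy y1 yz z0 n2 r5 HD; rewrite leNgt; apply/negP => H.
have h1 : 0 <= (rho - 5) * (2 * y - 1) * z by rewrite !mulr_ge0 //; lra.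
have h3 : 0 <= (n - 2) * z by rewrite !mulr_ge0 //; lra.
have H' : (1 + n + rho * (2 * y - 1) - 2 - 2 * z - 2 * D) * z < 0.
  by rewrite pmulr_llt0 //; lra.
nra.
Qed.

(** Here p and q are the weights of the W-neighbours of v and of z.  The two
    balance equations give (rho - 1) (y + z - 1) < p + q when rho > 3, and
    (rho - 1) z >= 1, so that the cost (p + q) z exceeds y + z - 1. *)
Lemma numeric_one_triangle (R : realFieldType) (rho y z p q : R) :
  z <= y -> y <= 1 -> 1 <= y + z -> 3 < rho -> 0 <= q ->
  rho * y = 1 + z + p -> rho * z = 1 + y + q ->
  (p + q) * z <= y + z - 1 -> False.
Proof.
move=> zy y1 yz r3 q0 ey ez H.
have pq : 0 < p + q by nra.
have : 0 <= (p + q) * ((rho - 1) * z - 1) by rewrite mulr_ge0 //; lra.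
nra.
Qed.

(** The lower bound for tau counts ordered pairs: k2 is twice the number
    of edges inside N, c the number of triangular edges between N and W, and f
    twice the number of those inside W. *)
Lemma few_triangular_edges (R : realFieldType) (k2 c f : R) (d n tau : nat) :
  (0 < d)%N -> d%:R + 1 <= n%:R :> R -> 2 * d%:R <= k2 ->
  k2 <= n%:R * (n%:R - 1) -> k2 + 2 * n%:R + 2 * c + f <= 2 * tau%:R ->
  0 <= c -> 0 <= f -> (tau < 5)%N ->
  [/\ d = 1%N, k2 <= 2, c < 2 & 3 <= tau%:R :> R].
Proof.
move=> d0 dn dk kn count c0 f0 tau5.
have d1 : 1 <= d%:R :> R by rewrite ler1n.
have tau4 : tau%:R <= 4 :> R by rewrite ler_nat.
have d_1 : d = 1%N.
  by apply/eqP; rewrite eqn_leq d0 andbT -ltnS -(ltr_nat R) /=; lra.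
have [n_2|n_3] := leqP n 2; last first.
  have n3 : 3 <= n%:R :> R by rewrite ler_nat.
  by split=> //; lra.
have n_2' : n%:R <= 2 :> R by rewrite ler_nat.
have n2 : n%:R = 2 :> R by lra.
by rewrite n2 in kn count; split=> //; lra.
Qed.

(** The same counts as above, together with the gain X (over ordered pairs)
    of the edges inside N. *)
Lemma many_triangular_edges (R : realFieldType) (rho y z P D k2 X c f : R)
    (d n tau : nat) :
  z <= y -> y <= 1 -> 0 < z -> 1 <= y + z -> z <= P -> P <= d%:R * z ->
  (0 < d)%N -> d%:R + 1 <= n%:R :> R -> 2 * d%:R <= k2 ->
  k2 <= n%:R * (n%:R - 1) -> k2 + 2 * n%:R + 2 * c + f <= 2 * tau%:R ->
  0 <= c -> 0 <= f -> (5 <= tau)%N ->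
  2 * (rho * y - 1 - P - D) <= c + f / 2 -> 2 * (D * P) <= X ->
  X <= (y + z - 1) * k2 - 2 * (z * d%:R - P) ->
  rho <= tau%:R.
Proof.
move=> zy y1 z0 yz zP Pd d0 dn dk kn count c0 f0 tau5 cI XD excess.
rewrite leNgt; apply/negP => lt.
have rho5 : 5 <= rho by apply: le_trans (ltW lt); rewrite ler_nat.
have DP : D * P <= P - d%:R * (1 - y) + (k2 / 2 - d%:R) * (y + z - 1).
  by clear -XD excess; lra.
have knrho : k2 / 2 + n%:R <= rho by clear -count c0 f0 lt; lra.
suff : rho <= k2 / 2 + n%:R + 2 * (rho * y - 1 - P - D).
  by clear -cI count lt c0 f0; lra.
have dk' : d%:R <= k2 / 2 by clear -dk; lra.
have [d_1|d_2] := leqP d 1; last first.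
  by apply: (@numeric_deg_ge2 _ _ _ z _ _ _ d%:R); rewrite // ?ler_nat.
have {d_1}d1 : d%:R = 1 :> R.
  by apply/eqP; rewrite pnatr_eq1 eqn_leq d_1 d0.
rewrite {}d1 in DP dk dn dk' Pd.
have Pz : P = z by apply/eqP; rewrite eq_le zP andbT -[z]mul1r.
rewrite Pz in DP *; rewrite mul1r in DP.
have [n_2|n_3] := leqP n 2; last first.
  by apply: numeric_deg1_apex_ge3; rewrite // ?ler_nat.
have n2' : n%:R <= 2 :> R by rewrite ler_nat.
have n2 : n%:R = 2 :> R by clear -n2' dn; lra.
have k2_2 : k2 / 2 = 1 by rewrite n2 in kn; clear -kn dk; lra.
rewrite k2_2 subrr mul0r addr0 in DP *.
by apply: numeric_deg1_apex2 => //; rewrite n2.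
Qed.

(** * Gains and costs around a heaviest vertex *)

Section HeaviestVertex.
Variables (R : realFieldType) (G : sgraph) (rho : R) (x : G -> R) (u : G).
Local Notation A a b := ((adj a b)%:R : R).
Implicit Types a b w : G.
Hypothesis x_ge0 : forall a, 0 <= x a.
Hypothesis x_le1 : forall a, x a <= 1.
Hypothesis x_u : x u = 1.
Hypothesis x_eig : forall a, \sum_b A a b * x b = rho * x a.
Hypothesis rho_gt0 : 0 < rho.
Hypothesis arcs_le : \sum_(a : G) \sum_(b : G) A a b <= 2 * rho ^+ 2.

Let N : {set G} := [set b | adj u b].
Let W : {set G} := [set b | (b != u) && ~~ adj u b].

Lemma A_sym a b : A a b = A b a. Proof. by rewrite adj_sym. Qed.

Lemma A_diag a : A a a = 0. Proof. by rewrite adj_irrefl. Qed.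

Lemma A_uW w : w \in W -> A u w = 0.
Proof. by rewrite inE => /andP[_ /negbTE ->]. Qed.

Lemma A_Wu w : w \in W -> A w u = 0.
Proof. by move=> /A_uW; rewrite A_sym. Qed.

Lemma A_uN b : b \in N -> A u b = 1.
Proof. by rewrite inE => ->. Qed.

Lemma A_Nu b : b \in N -> A b u = 1.
Proof. by move=> /A_uN; rewrite A_sym. Qed.

Lemma sum_split (F : G -> R) :
  \sum_b F b = F u + (\sum_(b in N) F b + \sum_(b in W) F b).
Proof.
rewrite (bigD1 u) //=; congr (_ + _).
rewrite (bigID (adj u)) /=; congr (_ + _); apply: eq_bigl => b; rewrite !inE //.
by case: eqP => // ->; rewrite adj_irrefl.
Qed.

Lemma sum_sym (S S' : {set G}) (F : G -> G -> R) :
  (forall a b, F a b = F b a) ->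
  \sum_(a in S) \sum_(b in S') F a b = \sum_(b in S') \sum_(a in S) F b a.
Proof.
by move=> sF; rewrite exchange_big; apply: eq_bigr => b _; apply: eq_bigr.
Qed.

(** The block decomposition of a symmetric matrix along {u}, N and W. *)
Lemma sum2_split (F : G -> G -> R) : (forall a b, F a b = F b a) ->
  \sum_a \sum_b F a b =
    F u u + 2 * \sum_(b in N) F u b + 2 * \sum_(b in W) F u b
    + \sum_(a in N) \sum_(b in N) F a b
    + 2 * \sum_(w in W) \sum_(b in N) F w b
    + \sum_(w in W) \sum_(b in W) F w b.
Proof.
move=> sF; have part (S : {set G}) : \sum_(a in S) \sum_b F a b =
    \sum_(b in S) F u b + (\sum_(a in S) \sum_(b in N) F a b +
      \sum_(a in S) \sum_(b in W) F a b).
  rewrite -!big_split /=; apply: eq_bigr => a _.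
  by rewrite sum_split (sF a u).
rewrite sum_split sum_split !part (sum_sym N W sF).
ring.
Qed.

Lemma rho_sumN : rho = \sum_(b in N) x b.
Proof.
rewrite -[LHS]mulr1 -x_u -x_eig sum_split A_diag mul0r add0r.
rewrite [X in _ + X]big1 => [|b /A_uW ->]; last by rewrite mul0r.
by rewrite addr0; apply: eq_bigr => b /A_uN ->; rewrite mul1r.
Qed.

Lemma row_N a : a \in N ->
  rho * x a = 1 + (\sum_(b in N) A a b * x b + \sum_(b in W) A a b * x b).
Proof. by move=> /A_Nu aN; rewrite -x_eig sum_split aN x_u mul1r. Qed.

Lemma row_W w : w \in W ->
  rho * x w = \sum_(b in N) A w b * x b + \sum_(b in W) A w b * x b.
Proof. by move=> /A_Wu aN; rewrite -x_eig sum_split aN mul0r add0r. Qed.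

Lemma swap_weight (S S' : {set G}) :
  \sum_(a in S) \sum_(b in S') A a b * x b =
  \sum_(b in S') \sum_(a in S) A b a * x b.
Proof.
rewrite exchange_big; apply: eq_bigr => b _; apply: eq_bigr => a _.
by rewrite A_sym.
Qed.

(** Compare rho^2 = rho * (sum of x over N), expanded by the eigenvalue equation
    at the vertices of N, with the number of edges, counted block by block. *)
Lemma edge_balance :
  \sum_(w in W) \sum_(b in W) A w b
    + 2 * \sum_(w in W) \sum_(b in N) A w b * (1 - x w)
  <= \sum_(a in N) \sum_(b in N) A a b * (x a + x b - 1).
Proof.
have rho2 : rho ^+ 2 = \sum_(a in N) 1 +
    (\sum_(a in N) \sum_(b in N) A a b * x b
     + \sum_(w in W) \sum_(b in N) A w b * x w).
  rewrite expr2 {2}rho_sumN mulr_sumr (eq_bigr _ row_N) !big_split /=.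
  by rewrite (swap_weight N W).
move: arcs_le; rewrite rho2 sum2_split; last exact: A_sym.
rewrite A_diag [\sum_(b in W) A u b]big1; last exact: A_uW.
rewrite (eq_bigr _ A_uN).
have -> : \sum_(a in N) \sum_(b in N) A a b * (x a + x b - 1) =
    2 * (\sum_(a in N) \sum_(b in N) A a b * x b)
    - \sum_(a in N) \sum_(b in N) A a b.
  rewrite mulr2n mulrDl mul1r {1}swap_weight -big_split -sumrB /=.
  apply: eq_bigr => a _; rewrite -big_split -sumrB /=.
  by apply: eq_bigr => b _; ring.
have -> : \sum_(w in W) \sum_(b in N) A w b * (1 - x w) =
    \sum_(w in W) \sum_(b in N) A w b - \sum_(w in W) \sum_(b in N) A w b * x w.
  rewrite -sumrB /=; apply: eq_bigr => a _; rewrite -sumrB /=.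
  by apply: eq_bigr => b _; ring.
lra.
Qed.

Definition miss w := \sum_(b in N) (1 - A w b) * x b.

Lemma miss_rho w : miss w = rho - \sum_(b in N) A w b * x b.
Proof.
rewrite {1}rho_sumN -sumrB; apply: eq_bigr => b _; ring.
Qed.

(** The neighbourhood of w weighs rho * x w <= rho, the weight of N: what w
    gains in W it must lose in N. *)
Lemma nbrW_le_miss w : w \in W -> \sum_(b in W) A w b * x b <= miss w.
Proof.
move=> /row_W E; rewrite miss_rho.
have : 0 <= rho * (1 - x w) by rewrite mulr_ge0 ?subr_ge0 // ltW.
lra.
Qed.

Let cross (S S' : {set G}) := \sum_(a in S) \sum_(b in S') A a b * (x a * x b).

(** By the eigenvalue equation at w, the second term of [edge_balance] is at
    least x w * miss w minus the weight of the W-neighbours of w, so that an edge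
    ww' inside W has gain x w + x w' - 1 <= x w * x w'.  The gains of the edges
    meeting W minus Z are charged to their ends outside Z, which can pay for them
    by [nbrW_le_miss]. *)
Lemma absorption (Z : {set G}) : Z \subset W ->
  2 * \sum_(w in Z) x w * miss w
    - \sum_(w in Z) \sum_(w' in Z) A w w' * (x w * x w')
  <= \sum_(a in N) \sum_(b in N) A a b * (x a + x b - 1).
Proof.
move=> ZW; apply: le_trans edge_balance.
have splitW (F : G -> R) :
    \sum_(w in W) F w = \sum_(w in Z) F w + \sum_(w in W :\: Z) F w.
  by rewrite (big_setID Z) /= (setIidPr ZW).
have cross_ge0 S S' : 0 <= cross S S'.
  by apply: sumr_ge0 => a _; apply: sumr_ge0 => b _; rewrite !mulr_ge0.
have crossW (S : {set G}) :
    \sum_(w in S) x w * (\sum_(b in W) A w b * x b) = cross S W.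
  apply: eq_bigr => w _; rewrite mulr_sumr; apply: eq_bigr => b _; ring.
have cross_sym S S' : cross S S' = cross S' S.
  by apply: sum_sym => a b; rewrite A_sym [x a * _]mulrC.
have crossYW : cross (W :\: Z) W <= \sum_(w in W :\: Z) x w * miss w.
  rewrite -crossW; apply: ler_sum => w; rewrite inE => /andP[_ wW].
  by rewrite ler_wpM2l // nbrW_le_miss.
have crossWW : cross W W <= cross Z Z + 2 * cross (W :\: Z) W.
  have splitl (S : {set G}) : cross W S = cross Z S + cross (W :\: Z) S.
    exact: splitW.
  have := cross_ge0 (W :\: Z) (W :\: Z).
  have := splitl W; have := splitl Z; have := splitl (W :\: Z).
  rewrite (cross_sym W Z) (cross_sym W (_ :\: _)) (cross_sym Z (_ :\: _)).
  lra.
have : \sum_(w in W) (x w * miss w - \sum_(b in W) A w b * x b)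
    <= \sum_(w in W) \sum_(b in N) A w b * (1 - x w).
  apply: ler_sum => w wW; rewrite -mulr_suml.
  have le : \sum_(b in N) A w b * x b <= \sum_(b in N) A w b.
    by apply: ler_sum => b _; rewrite ler_piMr.
  have := ler_wpM2r (_ : 0 <= 1 - x w) le; rewrite subr_ge0 => /(_ (x_le1 w)).
  by have := row_W wW; rewrite miss_rho; nra.
rewrite sumrB /= splitW => Wpart.
have : \sum_(w in W) \sum_(b in W) A w b * (x w + x b - 1) <= cross W W.
  apply: ler_sum => w _; apply: ler_sum => b _; rewrite ler_wpM2l //.
  have : 0 <= (1 - x w) * (1 - x b) by rewrite mulr_ge0 ?subr_ge0.
  lra.
have -> : \sum_(w in W) \sum_(b in W) A w b * (x w + x b - 1) =
    2 * (\sum_(w in W) \sum_(b in W) A w b * x b)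
    - \sum_(w in W) \sum_(b in W) A w b.
  rewrite mulr2n mulrDl mul1r {1}swap_weight -big_split -sumrB /=.
  apply: eq_bigr => a _; rewrite -big_split -sumrB /=.
  by apply: eq_bigr => b _; ring.
rewrite -/(cross Z Z).
lra.
Qed.

Lemma x_N_gt0 a : a \in N -> 0 < x a.
Proof.
move=> /row_N E; rewrite -(pmulr_rgt0 _ rho_gt0) E ltr_wpDr //.
by rewrite addr_ge0 // sumr_ge0 // => b _; rewrite mulr_ge0.
Qed.

(** Without edges inside N both terms on the left of [edge_balance] vanish, so
    W is independent and every w in W has weight 1; then w misses nothing. *)
Lemma independent_nbhd_complete :
  (forall a b, a \in N -> b \in N -> ~~ adj a b) ->
  (forall a, exists b, adj a b) ->
  forall a b, adj a b = ((a \in N) != (b \in N)).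
Proof.
move=> indN noiso.
have Wsum : \sum_(w in W) \sum_(b in W) A w b
    + 2 * \sum_(w in W) \sum_(b in N) A w b * (1 - x w) <= 0.
  apply: le_trans edge_balance _; rewrite big1 // => a aN.
  by rewrite big1 // => b bN; rewrite (negbTE (indN a b aN bN)) mul0r.
have WW_ge0 w : w \in W -> 0 <= \sum_(b in W) A w b.
  by move=> _; rewrite sumr_ge0.
have WN_ge0 w b : 0 <= A w b * (1 - x w) by rewrite mulr_ge0 ?subr_ge0.
have WN_ge0' w : w \in W -> 0 <= \sum_(b in N) A w b * (1 - x w).
  by move=> _; rewrite sumr_ge0.
have WW0 : \sum_(w in W) \sum_(b in W) A w b = 0.
  apply/eqP; rewrite eq_le sumr_ge0 // andbT.
  have : 0 <= \sum_(w in W) \sum_(b in N) A w b * (1 - x w) by exact: sumr_ge0.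
  by move: Wsum; lra.
have WN0 : \sum_(w in W) \sum_(b in N) A w b * (1 - x w) = 0.
  apply/eqP; rewrite eq_le sumr_ge0 // andbT.
  by move: Wsum; rewrite WW0; lra.
have indW w b : w \in W -> b \in W -> A w b = 0.
  move=> wW; have row0 := psumr_eq0P WW_ge0 WW0 wW.
  exact: (psumr_eq0P (fun c _ => ler0n R (adj w c)) row0).
have full w b : w \in W -> b \in N -> adj w b.
  move=> wW bN; have [c wc] := noiso w.
  have cN : c \in N.
    have := wc; rewrite inE; apply: contraLR => uc.
    have [cu|cu] := eqVneq c u.
      by have := A_Wu wW; rewrite cu; case: adj => // /eqP; rewrite oner_eq0.
    have cW : c \in W by rewrite inE cu.
    by have := indW w c wW cW; case: adj => // /eqP; rewrite oner_eq0.
  have xw : x w = 1.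
    have := psumr_eq0P (fun b _ => WN_ge0 w b)
      (psumr_eq0P WN_ge0' WN0 wW) cN.
    by rewrite wc mul1r => /eqP; rewrite subr_eq0 => /eqP.
  have miss0 : miss w = 0.
    have := row_W wW; rewrite xw mulr1 miss_rho => {1}->.
    rewrite [X in _ + X - _]big1 ?addr0 ?subrr // => c' c'W.
    by rewrite indW ?mul0r.
  have miss_ge0 b' : b' \in N -> 0 <= (1 - A w b') * x b'.
    by move=> _; case: adj; rewrite ?subrr ?mul0r ?subr0 ?mul1r.
  have := psumr_eq0P miss_ge0 miss0 bN; case: adj => //.
  by rewrite subr0 mul1r => xb; have := x_N_gt0 bN; rewrite xb ltxx.
have inW w : w \notin N -> w != u -> w \in W by rewrite !inE => -> ->.
have uN : u \notin N by rewrite inE adj_irrefl.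
move=> a b; have [aN|aN] := boolP (a \in N); have [bN|bN] := boolP (b \in N).
- exact/negbTE/indN.
- have [->|bu] := eqVneq b u.
    by rewrite adj_sym; move: aN; rewrite inE => ->.
  by rewrite adj_sym full // inW.
- have [->|au] := eqVneq a u; first by move: bN; rewrite inE => ->.
  by rewrite full // inW.
have [->|au] := eqVneq a u; first by move: bN; rewrite inE => /negbTE ->.
have [->|bu] := eqVneq b u.
  by rewrite adj_sym; move: aN; rewrite inE => /negbTE ->.
have := indW a b (inW a aN au) (inW b bN bu).
by case: adj => // /eqP; rewrite oner_eq0.
Qed.

(** * Counting triangular edges *)

Definition tri a b := adj a b && [exists c, adj a c && adj b c].
Local Notation T a b := ((tri a b)%:R : R).

Lemma triP a b c : adj a b -> adj a c -> adj b c -> tri a b.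
Proof.
by move=> ab ac bc; rewrite /tri ab; apply/existsP; exists c; rewrite ac.
Qed.

Lemma tri_sym a b : tri a b = tri b a.
Proof.
rewrite /tri adj_sym; congr (_ && _); apply: eq_existsb => c; exact: andbC.
Qed.

(** The triangular edges at u, between W and N, and (counted twice) inside W. *)
Let apexT := \sum_(b in N) T u b.
Let crossT := \sum_(w in W) \sum_(b in N) T w b.
Let farT := \sum_(w in W) \sum_(b in W) T w b.

Lemma tri_count :
  \sum_(a in N) \sum_(b in N) A a b + 2 * apexT + 2 * crossT + farT
  <= \sum_(a : G) \sum_(b : G) T a b.
Proof.
rewrite sum2_split => [|a b]; last by rewrite tri_sym.
have -> : \sum_(a in N) \sum_(b in N) A a b = \sum_(a in N) \sum_(b in N) T a b.
  apply: eq_bigr => a; rewrite inE => ua; apply: eq_bigr => b; rewrite inE => ub.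
  congr ((nat_of_bool _)%:R); apply/idP/idP => [ab|/andP[]//].
  by rewrite (triP ab (c := u)) // adj_sym.
have : 0 <= T u u by [].
have : 0 <= \sum_(b in W) T u b by rewrite sumr_ge0.
rewrite -/apexT -/crossT -/farT; lra.
Qed.

(** The row and the column of v meet only in the diagonal entry, which is 0. *)
Lemma sum2_ge_cross (F : G -> G -> R) v : v \in N -> (forall a b, 0 <= F a b) ->
  (forall a b, F a b = F b a) -> F v v = 0 ->
  2 * \sum_(b in N) F v b <= \sum_(a in N) \sum_(b in N) F a b.
Proof.
move=> vN F0 sF Fvv; rewrite [leRHS](bigD1 v) //= mulr2n mulrDl mul1r lerD2l.
rewrite (bigD1 v) //= Fvv add0r; apply: ler_sum => a _.
by rewrite (bigD1 v) //= sF lerDl sumr_ge0.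
Qed.

(** The edges from u to v and to the N-neighbours of v are triangular. *)
Lemma deg_lt_apexT v b : v \in N -> b \in N -> adj v b ->
  \sum_(c in N) A v c + 1 <= apexT.
Proof.
move=> vN bN vb; have uN c : c \in N -> adj u c by rewrite inE.
rewrite (bigD1 v) //= A_diag add0r addrC /apexT [leRHS](bigD1 v) //=; apply: lerD.
  by rewrite (triP (uN v vN) (uN b bN) vb).
apply: ler_sum => c /andP[cN _]; rewrite ler_nat.
by case vc: (adj v c) => //; rewrite (triP (uN c cN) (uN v vN)) // adj_sym.
Qed.

(** The edges inside N span only vertices b for which ub is triangular. *)
Lemma edgesN_le_apexT : \sum_(a in N) \sum_(b in N) A a b <= apexT * (apexT - 1).
Proof.
rewrite {1}/apexT mulr_suml; apply: ler_sum => a aN.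
have [/existsP [b /andP[bN ab]]|/existsPn noN] := boolP [exists b in N, adj a b].
  have := deg_lt_apexT aN bN ab.
  have -> : tri u a by apply: (triP (c := b)) => //; move: aN bN; rewrite !inE.
  by rewrite mul1r; lra.
rewrite big1 => [|b bN]; last by have := noN b; rewrite bN /= => /negbTE ->.
have -> : tri u a = false; last by rewrite mul0r.
apply/negbTE/negP => /andP[_ /existsP [c /andP[uc ac]]].
by have := noN c; rewrite inE uc ac.
Qed.

Let lone v : {set G} :=
  [set w in W | adj v w && ~~ [exists b in N, adj v b && adj w b]].

(** Let I be a maximal independent subset of the W-neighbours w of v for which
    vw is in no triangle with third vertex in N.  Any other W-neighbour w of v
    has a common neighbour b with v, in N or (by maximality) in I, and yields the
    two triangular edges vw and bw; these are distinct for distinct w. *)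
Lemma private_neighbours v : v \in N -> exists I : {set G},
  [/\ I \subset W,
      forall w, w \in I -> adj v w,
      forall w w', w \in I -> w' \in I -> ~~ adj w w',
      forall w b, w \in I -> b \in N -> adj v b -> ~~ adj w b &
      2 * (rho * x v - 1 - \sum_(b in N) A v b * x b - \sum_(w in I) x w)
        <= crossT + farT / 2].
Proof.
move=> vN; pose indep (I : {set G}) :=
  (I \subset lone v) && [forall w in I, forall w' in I, ~~ adj w w'].
have [I /maxsetP[/andP[IL /forall_inP indI] Imax] _] :
    {I | maxset indep I & set0 \subset I}.
  apply: maxset_exists; rewrite /indep sub0set.
  by apply/forall_inP => w; rewrite inE.
have indepI w w' : w \in I -> w' \in I -> ~~ adj w w'.
  by move=> /indI /forall_inP; apply.
have IP w : w \in I ->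
    [/\ w \in W, adj v w & ~~ [exists b in N, adj v b && adj w b]].
  by move=> /(subsetP IL); rewrite inE => /and3P.
have IW : I \subset W by apply/subsetP => w /IP[].
have dominated w : w \in lone v -> w \notin I -> exists2 c, c \in I & adj w c.
  move=> wL wI; apply/exists_inP; apply: contraR wI => /exists_inPn noc.
  suff -> : I = w |: I by rewrite setU11.
  apply/esym/Imax; last exact: subsetUr.
  rewrite /indep subUset sub1set wL IL.
  apply/forall_inP => a; rewrite in_setU1 => aI.
  apply/forall_inP => b; rewrite in_setU1 => bI.
  case/predU1P: aI => [->|aI]; case/predU1P: bI => [->|bI].
  - by rewrite adj_irrefl.
  - exact: noc.
  - by rewrite adj_sym noc.
  exact: indepI.
exists I; split=> // [w /IP[] //|w b /IP[_ _ noN] bN vb|].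
  by apply: contra noN => wb; apply/existsP; exists b; rewrite bN vb.
rewrite row_N //.
have -> : \sum_(b in W) A v b * x b = \sum_(w in I) x w
    + \sum_(w in W :\: I) A v w * x w.
  rewrite (big_setID I) /= (setIidPr IW); congr (_ + _).
  by apply: eq_bigr => w /IP[_ -> _]; rewrite mul1r.
set s := \sum_(w in W :\: _) _; rewrite [X in 2 * X](_ : _ = s); last by ring.
have far : \sum_(w in W :\: I) \sum_(c in I) T w c <= farT / 2.
  have splitW (F : G -> R) :
      \sum_(w in W) F w = \sum_(w in I) F w + \sum_(w in W :\: I) F w.
    by rewrite (big_setID I) /= (setIidPr IW).
  have ge0 (S S' : {set G}) : 0 <= \sum_(a in S) \sum_(b in S') T a b.
    by apply: sumr_ge0 => a _; apply: sumr_ge0.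
  have Tsym a b : T a b = T b a by rewrite tri_sym.
  have := ge0 I I; have := ge0 (W :\: I) (W :\: I).
  rewrite /farT splitW (sum_sym I W Tsym) splitW.
  have -> : \sum_(w in W :\: I) \sum_(b in W) T w b =
      \sum_(w in W :\: I) \sum_(c in I) T w c
      + \sum_(w in W :\: I) \sum_(c in W :\: I) T w c.
    by rewrite -big_split; apply: eq_bigr => w _; rewrite splitW.
  lra.
apply: le_trans (lerD (lexx _) far).
apply: (@le_trans _ _ (\sum_(w in W :\: I)
    (\sum_(b in N) T w b + \sum_(c in I) T w c))); last first.
  rewrite big_split lerD2r /crossT [leRHS](big_setID I) /= lerDr.
  by apply: sumr_ge0 => w _; apply: sumr_ge0.
rewrite mulr_sumr; apply: ler_sum => w; rewrite inE => /andP[wI wW].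
have Tge0 (S : {set G}) : 0 <= \sum_(b in S) T w b by rewrite sumr_ge0.
case vw: (adj v w); last by rewrite mul0r mulr0 addr_ge0.
have wv : adj w v by rewrite adj_sym.
have xw := x_le1 w; rewrite mul1r.
have [wL|] := boolP (w \in lone v).
  have [c cI wc] := dominated w wL wI; have [_ vc _] := IP c cI.
  have tv : tri w v := triP wv wc vc.
  have tc : tri w c by apply: (triP (c := v)); rewrite // adj_sym.
  rewrite (bigD1 v) //= (bigD1 c cI) /= tv tc.
  set r := \sum_(i | _) _; have : 0 <= r by rewrite sumr_ge0.
  set r' := \sum_(i in I | _) _; have : 0 <= r' by rewrite sumr_ge0.
  rewrite /=; lra.
rewrite inE wW vw /= negbK => /existsP [b /and3P[bN vb wb]].
have bv : b != v by apply: contraTneq vb => ->; rewrite adj_irrefl.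
have tv : tri w v := triP wv wb vb.
have tb : tri w b by apply: (triP (c := v)); rewrite // adj_sym.
rewrite (bigD1 v) //= (bigD1 b) ?bN //= tv tb.
set r := \sum_(i | _) _; have : 0 <= r by rewrite sumr_ge0.
have := Tge0 I; rewrite /=; lra.
Qed.


(** * From weights to triangular edges *)

(** The edges at v enter with their exact gain, the others with at most s. *)
Lemma excess_le v s : v \in N ->
  (forall a b, a \in N -> b \in N -> adj a b -> x a + x b - 1 <= s) ->
  \sum_(a in N) \sum_(b in N) A a b * (x a + x b - 1)
  <= s * (\sum_(a in N) \sum_(b in N) A a b)
     - 2 * ((s + 1 - x v) * (\sum_(b in N) A v b) - \sum_(b in N) A v b * x b).
Proof.
move=> vN smax.
pose F a b := if (a \in N) && (b \in N) then A a b * (s - (x a + x b - 1)) else 0.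
have F_ge0 a b : 0 <= F a b.
  rewrite /F; case: ifP => // /andP[aN bN].
  case ab: (adj a b); last by rewrite mul0r.
  by rewrite mul1r subr_ge0 smax.
have F_sym a b : F a b = F b a by rewrite /F andbC A_sym [x a + _]addrC.
have F_vv : F v v = 0 by rewrite /F A_diag mul0r if_same.
have := sum2_ge_cross vN F_ge0 F_sym F_vv.
have -> : \sum_(b in N) F v b =
    (s + 1 - x v) * (\sum_(b in N) A v b) - \sum_(b in N) A v b * x b.
  rewrite mulr_sumr -sumrB; apply: eq_bigr => b bN; rewrite /F vN bN /=; ring.
have -> : \sum_(a in N) \sum_(b in N) F a b =
    s * (\sum_(a in N) \sum_(b in N) A a b)
    - \sum_(a in N) \sum_(b in N) A a b * (x a + x b - 1).
  rewrite mulr_sumr -sumrB; apply: eq_bigr => a aN.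
  rewrite mulr_sumr -sumrB; apply: eq_bigr => b bN; rewrite /F aN bN /=; ring.
lra.
Qed.

(** A triangle with a vertex in W and one in N contains two triangular edges
    between W and N, wherever its third vertex lies. *)
Lemma no_cross_triangle : crossT < 2 -> forall w b c,
  w \in W -> b \in N -> adj w b -> adj w c -> adj b c -> False.
Proof.
move=> lt2 w b c wW bN wb wc bc; move: lt2; rewrite ltNge => /negP; apply.
have cu : c != u.
  apply: contraTneq wc => ->.
  by move: wW; rewrite inE => /andP[_]; rewrite adj_sym.
have bcne : b != c by apply: contraTneq bc => ->; rewrite adj_irrefl.
have wcne : w != c by apply: contraTneq wc => ->; rewrite adj_irrefl.
have twb : tri w b := triP wb wc bc.
have [cN|cN] := boolP (c \in N).
  have twc : tri w c by apply: (triP (c := b)) => //; rewrite adj_sym.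
  rewrite /crossT (bigD1 w) //= (bigD1 b) //= (bigD1 c) ?cN 1?eq_sym //= twb twc.
  set r := \sum_(i | _) T w i; have : 0 <= r by apply: sumr_ge0.
  set r' := \sum_(i | _) _; have : 0 <= r'.
    by apply: sumr_ge0 => i _; apply: sumr_ge0.
  by rewrite /=; lra.
have cW : c \in W by move: cN; rewrite !inE cu.
have tcb : tri c b by apply: (triP (c := w)) => //; rewrite adj_sym.
rewrite /crossT (bigD1 w) //= [X in _ + X](bigD1 c) ?cW 1?eq_sym //=.
rewrite (bigD1 b) //= [X in _ + (X + _)](bigD1 b) //= twb tcb.
set r := \sum_(i | _ && _ && _) _; have : 0 <= r.
  by apply: sumr_ge0 => i _; apply: sumr_ge0.
set r1 := \sum_(i | _) T w i; have : 0 <= r1 by apply: sumr_ge0.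
set r2 := \sum_(i | _) T c i; have : 0 <= r2 by apply: sumr_ge0.
by rewrite /=; lra.
Qed.

Lemma sum_nbr (S : {set G}) v (F : G -> R) :
  \sum_(b in S) A v b * F b = \sum_(b in [set b in S | adj v b]) F b.
Proof.
rewrite [RHS]big_mkcond [LHS]big_mkcond; apply: eq_bigr => b _; rewrite inE.
by case: (b \in S) => //=; case: adj; rewrite ?mul1r ?mul0r.
Qed.

(** Take for Z the W-neighbours of v and of z.  A member w of Z misses z or v,
    of weight at least x z, and a weight h w in the rest of N.  Adjacent members
    of Z have no common neighbour there, so their h add up to at least its total
    weight r'; hence h pays for all gains inside Z and the cost x z of each member
    remains. *)
Lemma one_triangle v z : v \in N -> z \in N -> adj v z -> x z <= x v ->
  1 <= x v + x z -> 3 < rho ->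
  \sum_(a in N) \sum_(b in N) A a b <= 2 -> crossT < 2 ->
  \sum_(a in N) \sum_(b in N) A a b * (x a + x b - 1) <= 2 * (x v + x z - 1) ->
  False.
Proof.
move=> vN zN vz zv vz1 rho3 edge1 /no_cross_triangle no_cross excess.
have zvne : z != v by apply: contraTneq vz => ->; rewrite adj_irrefl.
have single a b : a \in N -> b \in N -> adj a b ->
    \sum_(c in N) A a c * x c = x b.
  move=> aN bN ab; rewrite (bigD1 b) //= ab mul1r big1 ?addr0 //.
  move=> c /andP[cN cb].
  case ac: (adj a c); last by rewrite mul0r.
  have := sum2_ge_cross aN (fun c d => ler0n R (adj c d)) A_sym (A_diag a).
  rewrite (bigD1 b) //= (bigD1 c) ?cN //= ab ac.
  set r := \sum_(i | _) _; have : 0 <= r by rewrite sumr_ge0.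
  by move: edge1; rewrite /=; lra.
pose Z1 := [set w in W | adj v w]; pose Z2 := [set w in W | adj z w].
pose p := \sum_(w in Z1) x w; pose q := \sum_(w in Z2) x w.
have Ev : rho * x v = 1 + x z + p.
  by rewrite row_N // (single v z) // (sum_nbr W) addrA.
have Ez : rho * x z = 1 + x v + q.
  by rewrite row_N // (single z v) 1?adj_sym // (sum_nbr W) addrA.
have q0 : 0 <= q by rewrite sumr_ge0.
apply: (numeric_one_triangle zv (x_le1 v) vz1 rho3 q0 Ev Ez).
have Z1P w : w \in Z1 -> [/\ w \in W, adj w v & ~~ adj w z].
  rewrite inE => /andP[wW vw]; rewrite adj_sym vw; split=> //.
  by apply/negP => wz; apply: (no_cross w v z) => //; rewrite adj_sym.
have Z2P w : w \in Z2 -> [/\ w \in W, adj w z & ~~ adj w v].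
  rewrite inE => /andP[wW zw]; rewrite adj_sym zw; split=> //.
  by apply/negP => wv; apply: (no_cross w v z) => //; rewrite adj_sym.
have dis : [disjoint Z1 & Z2].
  rewrite disjoint_subset; apply/subsetP => w /Z1P[_ _ wz].
  by rewrite inE /= inE adj_sym (negbTE wz) andbF.
pose Z := Z1 :|: Z2.
have ZW : Z \subset W.
  by apply/subsetP => w; rewrite inE => /orP[/Z1P[]|/Z2P[]].
have sumZ F : \sum_(w in Z) F w = \sum_(w in Z1) F w + \sum_(w in Z2) F w :> R.
  by rewrite -bigU //; apply: eq_bigl => w; rewrite inE.
pose r' := rho - x v - x z.
pose h w := \sum_(b in N | (b != v) && (b != z)) (1 - A w b) * x b.
have r'E : r' = \sum_(b in N | (b != v) && (b != z)) x b.
  rewrite /r' rho_sumN (bigD1 v) //= (bigD1 z) ?zN //=.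
  under eq_bigl => i do rewrite -andbA.
  ring.
have h_ge0 w : 0 <= h w.
  apply: sumr_ge0 => b _; rewrite mulr_ge0 // subr_ge0; by case: adj.
have miss_ge w : w \in Z -> x z + h w <= miss w.
  have -> : miss w = (1 - A w v) * x v + (1 - A w z) * x z + h w.
    rewrite /miss (bigD1 v) //= (bigD1 z) ?zN //= addrA; congr (_ + _).
    by apply: eq_bigl => i; rewrite andbA.
  rewrite inE => /orP[/Z1P[_ -> /negbTE ->]|/Z2P[_ -> /negbTE ->]] /=.
    by lra.
  by lra.
have h_pair w w' : w \in W -> w' \in W -> adj w w' -> r' <= h w + h w'.
  move=> wW w'W ww'; rewrite r'E -big_split /=; apply: ler_sum => b /andP[bN _].
  have := x_ge0 b.
  case wb: (adj w b); case w'b: (adj w' b) => /=; try lra.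
  by case: (no_cross w b w'); rewrite // adj_sym.
have r'_gt0 : 0 < r' by have := x_le1 v; have := x_le1 z; rewrite /r'; lra.
have nbrZ w : w \in Z -> \sum_(b in Z) A w b * x b <= r'.
  have le1 (S : {set G}) : \sum_(b in S) A w b * x b <= \sum_(b in S) x b.
    by apply: ler_sum => b _; rewrite ler_piMl // lern1 leq_b1.
  have rho_x a : rho * x a <= rho by rewrite ger_pMr.
  have pr : p <= r' by have := x_le1 v; have := rho_x v; rewrite /r'; lra.
  have qr : q <= r' by have := x_le1 z; have := rho_x z; rewrite /r'; lra.
  rewrite inE sumZ => /orP[wZ|wZ].
    rewrite [X in X + _]big1 ?add0r => [|b bZ]; first exact: le_trans (le1 _) qr.
    have [[wW wv _] [bW bv _]] := (Z1P _ wZ, Z1P _ bZ).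
    case wb: (adj w b); last by rewrite mul0r.
    by case: (no_cross w v b); rewrite // adj_sym.
  rewrite [X in _ + X]big1 ?addr0 => [|b bZ]; first exact: le_trans (le1 _) pr.
  have [[wW wv _] [bW bv _]] := (Z2P _ wZ, Z2P _ bZ).
  case wb: (adj w b); last by rewrite mul0r.
  by case: (no_cross w z b); rewrite // adj_sym.
have := absorption ZW; set crossZ := (\sum_(w in Z) \sum_(w' in Z) _) => abs.
(* weigh each pair of adjacent w, w' by (h w + h w') / r' >= 1 *)
have crossZ_le : crossZ <= 2 * \sum_(w in Z) x w * h w.
  rewrite -(ler_pM2l r'_gt0).
  apply: (@le_trans _ _ (\sum_(w in Z) \sum_(w' in Z)
      (A w w' * (x w * x w') * h w + A w w' * (x w * x w') * h w'))).
    rewrite mulr_sumr; apply: ler_sum => w wZ; rewrite mulr_sumr.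
    apply: ler_sum => w' w'Z; rewrite -mulrDr.
    case ww': (adj w w'); last by rewrite !mul0r mulr0.
    by rewrite mulrC ler_wpM2l ?mulr_ge0 // h_pair // (subsetP ZW).
  under eq_bigr => w _ do rewrite big_split.
  rewrite big_split /= [X in _ + X]exchange_big /=.
  have -> : \sum_(w' in Z) \sum_(w in Z) A w w' * (x w * x w') * h w' =
      \sum_(w in Z) \sum_(w' in Z) A w w' * (x w * x w') * h w.
    apply: eq_bigr => w' _; apply: eq_bigr => w _.
    by rewrite A_sym [x w * _]mulrC.
  suff : \sum_(w in Z) \sum_(w' in Z) A w w' * (x w * x w') * h w
      <= r' * \sum_(w in Z) x w * h w by lra.
  rewrite mulr_sumr; apply: ler_sum => w wZ.
  have -> : \sum_(w' in Z) A w w' * (x w * x w') * h w =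
      x w * h w * \sum_(w' in Z) A w w' * x w'.
    by rewrite mulr_sumr; apply: eq_bigr => w' _; ring.
  by rewrite [leRHS]mulrC ler_wpM2l ?mulr_ge0 // nbrZ.
have missZ : \sum_(w in Z) x w * x z + \sum_(w in Z) x w * h w
    <= \sum_(w in Z) x w * miss w.
  rewrite -big_split /=; apply: ler_sum => w wZ.
  by rewrite -mulrDr ler_wpM2l // miss_ge.
move: missZ; rewrite -mulr_suml sumZ -/p -/q; lra.
Qed.


(** [one_triangle] excludes tau < 5; otherwise the conclusion is the numerical
    inequality [many_triangular_edges]. *)
Lemma triangular_ge_rho v z (tau : nat) : v \in N -> z \in N -> adj v z ->
  x z <= x v ->
  (forall a b, a \in N -> b \in N -> adj a b -> x a + x b <= x v + x z) ->
  \sum_(a : G) \sum_(b : G) T a b = 2 * tau%:R ->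
  rho <= tau%:R.
Proof.
move=> vN zN vz zv vzmax tauE; rewrite leNgt; apply/negP => tau_lt.
have yle1 := x_le1 v; have z0 := x_N_gt0 zN.
have smax a b : a \in N -> b \in N -> adj a b -> x a + x b - 1 <= x v + x z - 1.
  by move=> aN bN ab; rewrite lerD2r vzmax.
have count := tri_count; rewrite tauE in count.
have kn := edgesN_le_apexT; have dn := deg_lt_apexT vN zN vz.
have dk := sum2_ge_cross vN (fun c d => ler0n R (adj c d)) A_sym (A_diag v).
have exc := excess_le vN smax.
have exc0 := absorption (sub0set W); rewrite !big_set0 mulr0 subr0 in exc0.
have [I [IW Iv indI privI crossI]] := private_neighbours vN.
have absI : 2 * ((\sum_(w in I) x w) * (\sum_(b in N) A v b * x b)) <=
    \sum_(a in N) \sum_(b in N) A a b * (x a + x b - 1).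
  apply: le_trans (absorption IW); rewrite [X in _ - X]big1 ?subr0 => [|w wI].
    rewrite ler_pM2l // mulr_suml; apply: ler_sum => w wI.
    rewrite ler_wpM2l //; apply: ler_sum => b bN; rewrite ler_wpM2r //.
    case vb: (adj v b) => /=; last by rewrite subr_ge0 lern1 leq_b1.
    by rewrite (negbTE (privI w b wI bN vb)) subr0.
  by rewrite big1 // => w' w'I; rewrite (negbTE (indI w w' wI w'I)) mul0r.
have Pd : \sum_(b in N) A v b * x b <= (\sum_(b in N) A v b) * x z.
  rewrite mulr_suml; apply: ler_sum => b bN.
  case vb: (adj v b); rewrite ?mul0r // !mul1r.
  by have := vzmax v b vN bN vb; rewrite lerD2l.
have zP : x z <= \sum_(b in N) A v b * x b.
  by rewrite (bigD1 z) //= vz mul1r lerDl sumr_ge0 // => b _; rewrite mulr_ge0.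
have [d dE] : exists d : nat, \sum_(b in N) A v b = d%:R.
  by exists (\sum_(b in N) adj v b)%N; rewrite natr_sum.
have [n nE] : exists n : nat, apexT = n%:R.
  by exists (\sum_(b in N) tri u b)%N; rewrite natr_sum.
have ct0 : 0 <= crossT by apply: sumr_ge0 => w _; apply: sumr_ge0.
have ft0 : 0 <= farT by apply: sumr_ge0 => w _; apply: sumr_ge0.
have d1 : (0 < d)%N.
  rewrite lt0n; apply/eqP => d_0; move: Pd; rewrite dE d_0 mul0r leNgt.
  by rewrite (lt_le_trans z0 zP).
have tri_one := one_triangle vN zN vz zv.
rewrite dE nE in count kn dn dk exc Pd.
have zE : x v + x z - 1 + 1 - x v = x z by ring.
rewrite zE in exc; move: count kn dk exc exc0 tri_one crossI absI Pd zP.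
set k2 := \sum_(a in N) \sum_(b in N) A a b.
set X := \sum_(a in N) \sum_(b in N) A a b * _.
set P := \sum_(b in N) A v b * _; set D := \sum_(w in I) _.
move=> count kn dk exc exc0 tri_one crossI absI Pd zP.
have yz : 1 <= x v + x z.
  have k2_gt0 : 0 < k2 by apply: lt_le_trans dk; rewrite mulr_gt0 ?ltr0n.
  have zd : 0 <= x z * d%:R - P by rewrite subr_ge0 mulrC.
  rewrite -subr_ge0 -(pmulr_lge0 _ k2_gt0).
  by apply: le_trans exc0 (le_trans exc _); rewrite gerBl mulr_ge0.
have [tau4|tau5] := ltnP tau 5.
  have [d_1 k2_2 c2 tau3] := few_triangular_edges d1 dn dk kn count ct0 ft0 tau4.
  apply: tri_one => //; first exact: le_lt_trans tau_lt.
  rewrite d_1 mulr1 mul1r in exc Pd.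
  have Pz : P = x z by apply/eqP; rewrite eq_le Pd.
  apply: le_trans exc _; rewrite Pz subrr mulr0 subr0 mulrC.
  by rewrite ler_wpM2r // subr_ge0.
have := many_triangular_edges zv yle1 z0 yz zP Pd d1 dn dk kn count ct0 ft0 tau5
  crossI absI exc.
by rewrite leNgt tau_lt.
Qed.
End HeaviestVertex.

(** * Graphs and the main theorem *)

Lemma card_unordered_pairs (G : finType) (e : rel G) :
  symmetric e -> irreflexive e ->
  (\sum_(a : G) \sum_(b : G) e a b)%N =
    (2 * #|[set [set p.1; p.2] | p : G * G & e p.1 p.2]|)%N.
Proof.
move=> e_sym e_irr; rewrite (pair_bigA _ (fun a b : G => e a b : nat)) /=.
rewrite (eq_bigr (fun p : G * G => if e p.1 p.2 then 1 else 0)%N); last first.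
  by move=> p _; case: ifP.
rewrite -big_mkcond (eq_bigl (fun p => p \in [set p | e p.1 p.2])); last first.
  by move=> p; rewrite inE.
rewrite (partition_big_imset (fun p : G * G => [set p.1; p.2])) /=.
rewrite mulnC -sum_nat_const.
rewrite (_ : [set _ | _ in _] =
    [set [set p.1; p.2] | p in [set p | e p.1 p.2]]); last first.
  apply/setP => s; apply/imsetP/imsetP => -[p]; rewrite inE => ep ->;
    by exists p; rewrite ?inE.
(* the fibre over the edge {a, b} consists of (a, b) and (b, a) *)
apply: eq_bigr => s /imsetP[[a b]]; rewrite inE /= => ab ->.
have ab_ne : (a, b) != (b, a).
  by apply: contraTneq ab => -[-> _]; rewrite e_irr.
rewrite sum1dep_card -[RHS]/(true.+1) -ab_ne -cards2; apply: eq_card => -[c d].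
rewrite !inE /= !xpair_eqE; apply/andP/orP => [[cd /eqP E]|].
  have cab : c \in [set a; b] by rewrite -E set21.
  have dab : d \in [set a; b] by rewrite -E set22.
  case/set2P: cab cd => ->; case/set2P: dab => ->; rewrite ?e_irr ?eqxx //=.
    by left.
  by right.
case=> /andP[/eqP-> /eqP->]; first by rewrite ab eqxx.
by rewrite e_sym ab setUC eqxx.
Qed.

Lemma triangular_edgesE (G : sgraph) :
  triangular_edges G = [set [set p.1; p.2] | p : G * G & tri p.1 p.2].
Proof.
apply/setP => f; rewrite inE; apply/andP/imsetP.
  case=> /imsetP [[a b]]; rewrite inE /= => ab ->.
  move=> /existsP[t /andP[/andP[t3 /forall_inP tadj]]].
  rewrite subUset !sub1set => /andP[at_ bt].
  exists (a, b) => //; rewrite inE /= /tri ab /=.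
  have [c ct cn] : exists2 c, c \in t & c \notin [set a; b].
    apply/subsetPn; apply/negP => /subset_leq_card; rewrite (eqP t3) cards2.
    by case: (a != b).
  move: cn; rewrite !inE negb_or => /andP[ca cb]; apply/existsP; exists c.
  have := forall_inP (tadj a at_) c ct; have := forall_inP (tadj b bt) c ct.
  by rewrite ![_ == c]eq_sym ca cb /= => -> ->.
case=> [[a b]]; rewrite inE /= => /andP[ab /existsP[c /andP[ac bc]]] ->.
split; first by apply/imsetP; exists (a, b); rewrite ?inE.
have ne (p q : G) : adj p q -> p != q.
  by apply: contraTneq => ->; rewrite adj_irrefl.
apply/existsP; exists (c |: [set a; b]); rewrite subsetUr andbT /is_triangle.
rewrite cardsU1 cards2 !inE negb_or ![c == _]eq_sym.
rewrite (ne _ _ ac) (ne _ _ bc) (ne _ _ ab) /=.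
apply/forall_inP => p; rewrite !inE => pt.
apply/forall_inP => q; rewrite !inE => qt.
by case/or3P: pt => /eqP->; case/or3P: qt => /eqP->;
  rewrite ?eqxx ?ab ?ac ?bc ?implybT //=;
  rewrite adj_sym ?ab ?ac ?bc implybT.
Qed.

Lemma complete_bipartiteP (G : sgraph) (L : {set G}) a0 b0 :
  a0 \in L -> b0 \notin L ->
  (forall a b : G, adj a b = ((a \in L) != (b \in L))) ->
  isomorphic G (complete_bipartite #|L| #|~: L|).
Proof.
move=> aL bL adjE; have bL' : b0 \in ~: L by rewrite inE.
pose f (a : G) : 'I_#|L| + 'I_#|~: L| :=
  if a \in L then inl (enum_rank_in aL a) else inr (enum_rank_in bL' a).
pose g (s : 'I_#|L| + 'I_#|~: L|) : G :=
  match s with inl i => enum_val i | inr j => enum_val j end.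
exists f.
  exists g => [a|[i|j]]; rewrite /f /g.
  - case: ifP => aL'; first by rewrite enum_rankK_in.
    by rewrite enum_rankK_in // inE aL'.
  - by rewrite enum_valP enum_valK_in.
  have := enum_valP j; rewrite inE => /negbTE ->; by rewrite enum_valK_in.
move=> a b; rewrite adjE /f.
by case: (a \in L); case: (b \in L).
Qed.

Theorem theorem1p11 (R : realType) (G : sgraph) (m : nat) (rho : R)
  (nonempty : (0 < #|G|)%N)
  (size_G : #|edges G| = m)
  (noiso : no_isolated G)
  (rhoP : is_spectral_radius G rho)
  (rho_ge : Num.sqrt (m%:R : R) <= rho)
  (not_kab : forall a b : nat, (0 < a)%N -> (0 < b)%N ->
     ~ isomorphic G (complete_bipartite a b)) :
  rho <= (#|triangular_edges G|)%:R.
Proof.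
have [x [x_ge0 x_eig [u x_u x_le1]]] := perron rhoP.
have [w uw] := noiso u.
have m_gt0 : (0 < m)%N.
  rewrite -size_G card_gt0; apply/set0Pn; exists [set u; w].
  by apply/imsetP; exists (u, w); rewrite ?inE.
have rho_gt0 : 0 < rho by apply: lt_le_trans rho_ge; rewrite sqrtr_gt0 ltr0n.
have sum_nat (e : rel G) :
    \sum_a \sum_b (e a b)%:R = (\sum_a \sum_b e a b)%:R :> R.
  by rewrite natr_sum; apply: eq_bigr => a _; rewrite natr_sum.
have arcs : \sum_(a : G) \sum_(b : G) (adj a b)%:R <= 2 * rho ^+ 2.
  rewrite sum_nat (card_unordered_pairs (@adj_sym G) (@adj_irrefl G)).
  rewrite -/(edges G) size_G natrM ler_pM2l // -[m%:R]sqr_sqrtr ?ler0n //.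
  by rewrite ler_sqr ?nnegrE ?sqrtr_ge0 // ltW.
pose edgeN (p : G * G) := [&& adj u p.1, adj u p.2 & adj p.1 p.2].
have [/existsP [p0 p0N]|/existsPn noN] := boolP [exists p, edgeN p]; last first.
  have indep (a b : G) : a \in [set c | adj u c] -> b \in [set c | adj u c] ->
      ~~ adj a b.
    by rewrite !inE => ua ub; have := noN (a, b); rewrite /edgeN /= ua ub.
  have adjE := independent_nbhd_complete x_ge0 x_le1 x_u x_eig rho_gt0 arcs
    indep noiso.
  have wN : w \in [set c | adj u c] by rewrite inE.
  have uN : u \notin [set c | adj u c] by rewrite inE adj_irrefl.
  case: (not_kab _ _ _ _ (complete_bipartiteP wN uN adjE)).
    by rewrite card_gt0; apply/set0Pn; exists w.
  by rewrite card_gt0; apply/set0Pn; exists u; rewrite inE.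
have [[v z] /and3P[/= uv uz vz] pmax] :=
  @arg_maxP _ _ _ p0 edgeN (fun p => x p.1 + x p.2) p0N.
have tauE : \sum_(a : G) \sum_(b : G) (tri a b)%:R =
    2 * #|triangular_edges G|%:R :> R.
  rewrite sum_nat card_unordered_pairs -?triangular_edgesE ?natrM //.
    exact: tri_sym.
  by move=> a; rewrite /tri adj_irrefl.
have vzmax (a b : G) : a \in [set c | adj u c] -> b \in [set c | adj u c] ->
    adj a b -> x a + x b <= x v + x z.
  by rewrite !inE => ua ub ab; apply: (pmax (a, b)); rewrite /edgeN /= ua ub.
have vN : v \in [set c | adj u c] by rewrite inE.
have zN : z \in [set c | adj u c] by rewrite inE.
have [zv|/ltW vz'] := leP (x z) (x v).
  exact: (triangular_ge_rho x_ge0 x_le1 x_u x_eig rho_gt0 arcs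
    vN zN vz zv vzmax tauE).
have zv : adj z v by rewrite adj_sym.
have zvmax (a b : G) : a \in [set c | adj u c] -> b \in [set c | adj u c] ->
    adj a b -> x a + x b <= x z + x v.
  by rewrite [x z + _]addrC; exact: vzmax.
exact: (triangular_ge_rho x_ge0 x_le1 x_u x_eig rho_gt0 arcs
  zN vN zv vz' zvmax tauE).
Qed.
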